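(* Let $E$ be a real normed vector space and let $f,f_n\in\Lambda(E)$ $(n\ge1)$. Assume that $f(x)=\sum_{n\geq 1}f_n(x)$ for every $x\in E$. If $f$ and $f_n$ (for every $n\ge1$) are continuous on $\operatorname{int}(\operatorname{dom}f)$ and the series $\sum_{n\ge1}f_n$ converges uniformly on a nonempty open subset of $\operatorname{dom}f$, then $$\partial f(x)=\|\cdot\|\text{-}\sum_{n\ge1}\partial f_n(x)\qquad\forall x\in\operatorname{int}(\operatorname{dom}f),$$ that is, for every $x\in\operatorname{int}(\operatorname{dom}f)$ the sequence of sets $(\partial f_n(x))_{n\ge1}$ converges normally to $\partial f(x)$ with respect to the (dual) norm topology of $E^*$. Moreover, for every $x\in\operatorname{int}(\operatorname{dom}f)$ there is a neighborhood of $x$ on which $\lim_{n\to\infty}\big\|\sum_{k\ge n}\partial f_k(\cdot)\big\|=0$ uniformly.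
   Context: $E^*$ is the topological dual of $E$, with pairing $\langle x,x^*\rangle$. $\Lambda(E)$ is the set of proper convex functions $f:E\to(-\infty,\infty]$ (proper: not identically $\infty$); $\operatorname{dom}f=\{x: f(x)<\infty\}$. The equality $f(x)=\sum_{n\ge1}f_n(x)$ means that $\lim_{n\to\infty}\sum_{k=1}^n f_k(x)$ exists in $[-\infty,\infty]$ and equals $f(x)$. For $x\in \operatorname{dom} f$, $\partial f(x)=\{x^*\in E^*: \langle y-x,x^*\rangle\le f(y)-f(x)\ \forall y\in E\}$ is the subdifferential. Normal convergence: let $(F,\tau)$ be a real separated locally convex space and let $A, A_n$ $(n\ge1)$ be nonempty subsets of $F$. The notation $(x_n)_{n\ge1}\subset(A_n)_{n\ge1}$ means $x_n\in A_n$ for every $n\ge1$. One says that $(A_n)_{n\ge1}$ converges normally to $A$ with respect to $\tau$, written $A=\tau\text{-}\sum_{n\ge1}A_n$, if: (I) for every sequence $(x_n)_{n\ge1}\subset(A_n)_{n\ge1}$ the series $\sum_{n\ge1}x_n$ is $\tau$-convergent and its sum belongs to $A$; (II) for each $\tau$-neighborhood $U$ of $0$ in $F$ there is $n_0\ge1$ such that $\sum_{k\ge n}x_k\in U$ for all sequences $(x_n)_{n\ge1}\subset(A_n)_{n\ge1}$ and all $n\ge n_0$; (III) for each $x\in A$ there exists $(x_n)_{n\ge1}\subset(A_n)_{n\ge1}$ such that $x=\tau\text{-}\sum_{n\ge1}x_n$ (i.e. $x$ is the $\tau$-limit of the partial sums). For $\emptyset\ne A\subset E^*$, $\|A\|:=\sup\{\|x^*\|: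 x^*\in A\}$. The set $\sum_{k\ge n}\partial f_k(y)$ is the norm-normal sum, i.e. the set of all sums $\sum_{k\ge n}x_k^*$ (norm convergent series) with $x_k^*\in\partial f_k(y)$ for $k\ge n$. *)

(* Defs.v *)
From HB Require Import structures.
From mathcomp Require Import all_boot all_order all_algebra.
From mathcomp Require Import all_classical all_reals all_analysis.

Set Implicit Arguments.
Unset Strict Implicit.
Unset Printing Implicit Defensive.

Import Order.TTheory GRing.Theory Num.Theory.
Import numFieldNormedType.Exports.

Local Open Scope classical_set_scope.
Local Open Scope ring_scope.

Section TopologicalDual.
Context (R : realType) (E : normedModType R).

(* Continuity is for the norm topology of E; [dual] is the space of these
   functionals, normed below by the supremum over the closed unit ball. *)
Definition cont_linear : {pred (E -> R^o)} :=
  [pred p | `[< linear p /\ continuous p >]].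

Record dual := Dual { dual_fun :> E -> R^o ; _ : dual_fun \in cont_linear }.

HB.instance Definition _ := [isSub for dual_fun].
HB.instance Definition _ := [Choice of dual by <:].

Lemma cont_linear_submod : submod_closed cont_linear.
Proof.
split=> [|a p q /asboolP[lp cp] /asboolP[lq cq]]; apply/asboolP; split.
- by move=> b u v; rewrite /GRing.zero/= scaler0 addr0.
- by move=> x; exact: cvg_cst.
- move=> b u v; rewrite !fctE lp lq !scalerDr !scalerA [b * a]mulrC.
  by rewrite addrACA.
- move=> x; apply: (@cvgD _ _ _ _ _ (a *: p) q); last exact: cq.
  by apply: cvgZr; exact: cp.
Qed.

HB.instance Definition _ :=
  GRing.isSubmodClosed.Build R (E -> R^o) cont_linear cont_linear_submod.
HB.instance Definition _ := [SubChoice_isSubLmodule of dual by <:].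

Lemma dual_linear (p : dual) : linear p.
Proof. by case: p => p /= /asboolP[]. Qed.

HB.instance Definition _ (p : dual) :=
  GRing.isLinear.Build R E R^o *:%R p (dual_linear p).

Lemma dual_continuous (p : dual) : continuous p.
Proof. by case: p => p /= /asboolP[]. Qed.

Definition dual_norm (p : dual) : R :=
  sup [set `|p x| | x in [set x : E | `|x| <= 1]].

Lemma dual_norm_has_sup (p : dual) :
  has_sup [set `|p x| | x in [set x : E | `|x| <= 1]].
Proof.
split; first by exists `|p 0|, 0 => //=; rewrite normr0.
have /continuous_linear_bounded/linear_boundedP[M [Mr /(_ (M + 1))]] :
  {for 0, continuous p} by exact: dual_continuous.
rewrite ltrDl ltr01 => /(_ isT) pM.
exists `|M + 1| => _ [x /= x1 <-]; rewrite (le_trans (pM x))//.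
by rewrite (le_trans (ler_wpM2r _ (ler_norm _)))// ler_piMr.
Qed.

Lemma dual_norm_ub (p : dual) (x : E) : `|x| <= 1 -> `|p x| <= dual_norm p.
Proof.
by move=> x1; apply: (sup_upper_bound (dual_norm_has_sup p)); exists x.
Qed.

Lemma dual_norm_le (p : dual) (M : R) :
  (forall x : E, `|x| <= 1 -> `|p x| <= M) -> dual_norm p <= M.
Proof.
move=> pM; apply: ge_sup => [|_ [x x1 <-]]; last exact: pM.
by case: (dual_norm_has_sup p).
Qed.

Lemma dual_norm_ge0 (p : dual) : 0 <= dual_norm p.
Proof. by apply: (le_trans (normr_ge0 (p 0))); rewrite dual_norm_ub ?normr0. Qed.

Lemma dual_normD (p q : dual) : dual_norm (p + q) <= dual_norm p + dual_norm q.
Proof.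
apply: dual_norm_le => x x1; apply: (le_trans (ler_normD (p x) (q x))).
by rewrite lerD// dual_norm_ub.
Qed.

Lemma dual_normZ (a : R) (p : dual) : dual_norm (a *: p) = `|a| * dual_norm p.
Proof.
have leZ b q : dual_norm (b *: q) <= `|b| * dual_norm q.
  apply: dual_norm_le => x x1.
  have -> : (b *: q) x = b * q x by [].
  by rewrite normrM ler_wpM2l// dual_norm_ub.
apply/eqP; rewrite eq_le leZ/=.
have [->|a0] := eqVneq a 0; first by rewrite normr0 mul0r dual_norm_ge0.
rewrite -ler_pdivlMl ?normr_gt0// -normfV.
by rewrite (le_trans _ (leZ _ _))// scalerA mulVf// scale1r.
Qed.

Lemma dual_norm0_eq0 (p : dual) : dual_norm p = 0 -> p = 0.
Proof.
move=> p0; apply/val_inj/funext => x /=.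
have [->|x0] := eqVneq x 0; first by rewrite linear0.
have nx : `|x| != 0 by rewrite normr_eq0.
have : `|p (`|x|^-1 *: x)| <= 0.
  by rewrite -p0 dual_norm_ub// normrZ normfV normr_id mulVf.
rewrite normr_le0 linearZ/= scaler_eq0 invr_eq0 (negbTE nx)/=.
by move=> /eqP.
Qed.

HB.instance Definition _ := @Lmodule_isNormed.Build R dual
  dual_norm dual_normD dual_normZ dual_norm0_eq0.

Lemma dual_normE (p : dual) :
  `|p| = sup [set `|p x| | x in [set x : E | `|x| <= 1]].
Proof. by []. Qed.

End TopologicalDual.
Section NormalConvergence.
Context (R : realType) (F : tvsType R).

(* s is a sum of the series of the x_ k over k >= n.  Limits are expressed as a
   relation; sums are unique as soon as F is separated. *)
Definition sums_to (n : nat) (x_ : F^nat) (s : F) :=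
  (fun m => \sum_(n <= k < m) x_ k) @ \oo --> s.

Definition selection (n : nat) (A_ : nat -> set F) (x_ : F^nat) :=
  forall k, (n <= k)%N -> A_ k (x_ k).

Definition normal_cvg (A_ : nat -> set F) (A : set F) :=
  (A !=set0 /\ forall k, A_ k !=set0) /\
  [/\ forall x_, selection 0 A_ x_ -> exists2 s, sums_to 0 x_ s & A s,
      forall U, nbhs (0 : F) U -> exists n0, forall x_, selection 0 A_ x_ ->
        forall n, (n0 <= n)%N -> exists2 s, sums_to n x_ s & U s
    & forall x, A x -> exists2 x_, selection 0 A_ x_ & sums_to 0 x_ x].

Definition tail_sum (n : nat) (A_ : nat -> set F) : set F :=
  [set s | exists2 x_, selection n A_ x_ & sums_to n x_ s].

End NormalConvergence.

Definition set_norm (R : realType) (V : normedModType R) (A : set V) : \bar R :=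
  ereal_sup [set `|v|%:E | v in A].

Section ConvexFunctions.
Context (R : realType) (E : normedModType R).
Local Open Scope ereal_scope.
Implicit Types f : E -> \bar R.

Definition dom f : set E := [set x | f x < +oo].

Definition convex_efun f := forall (x y : E) (t : R), (0 < t < 1)%R ->
  f (t *: x + (1 - t) *: y)%R <= t%:E * f x + (1 - t)%:E * f y.

Definition proper_convex f :=
  [/\ forall x, f x != -oo, dom f !=set0 & convex_efun f].

Definition subdiff f (x : E) : set (dual E) :=
  [set p | dom f x /\ forall y, (p (y - x)%R)%:E <= f y - f x].

End ConvexFunctions.

(* Main.v *)
(* Let [g n] be the remainder [f - f_0 - ... - f_(n-1)], a convex function on
   [dom f].  Uniform smallness of [g n] on one ball propagates by convexity to a
   ball around every interior point of [dom f], and a convex function that is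
   uniformly small on a ball only has small subgradients on the half ball.
   Partial sums [x_n + ... + x_(m-1)] of subgradients are subgradients of
   [g n - g m], hence Cauchy, and their sum is a subgradient of [g n]; this gives
   (I), (II) and the uniform statement.  For (III), the sum rule for two convex
   functions, a consequence of Hahn-Banach, splits a subgradient of
   [g n = f_n + g (n+1)] into one of [f_n] and one of [g (n+1)]; iterating from
   [g 0 = f] leaves remainders in the subdifferential of [g n], which tend to 0
   in norm. *)
Require Import Defs.
From HB Require Import structures.
From mathcomp Require Import all_boot all_order all_algebra.
From mathcomp Require Import all_classical all_reals all_analysis.
From mathcomp Require Import ring lra.
Import Order.TTheory GRing.Theory Num.Theory.
Import numFieldNormedType.Exports.
Local Open Scope classical_set_scope.
Local Open Scope ring_scope.

(** * Sublinear functionals and the Hahn-Banach theorem *)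

Definition sublinear {R : realType} {V : lmodType R} (q : V -> R) :=
  (forall x y, q (x + y) <= q x + q y) /\
  (forall t x, 0 < t -> q (t *: x) = t * q x).

Section HahnBanach.
Context {R : realType} {V : lmodType R}.
Implicit Types (p q : V -> R) (x y : V).

Lemma sublinear0 {q} : sublinear q -> q 0 = 0.
Proof.
move=> [_ qZ]; have := qZ 2 0 (ltr0Sn R 1).
by rewrite scaler0 => ?; lra.
Qed.

Lemma sublinear_geN {q} x : sublinear q -> - q (- x) <= q x.
Proof.
move=> sq; have := sq.1 x (- x); rewrite subrr (sublinear0 sq) => ?; lra.
Qed.

(** A common scheme for four infima: the regularization along a direction, the infimum of a chain,
    the directional derivative and the infimal convolution. *)
Lemma sublinear_inf (S : V -> set R) : (forall x, has_inf (S x)) ->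
  (forall x y a b, S x a -> S y b -> exists2 c, S (x + y) c & c <= a + b) ->
  (forall t x a, 0 < t -> S x a -> S (t *: x) (t * a)) ->
  sublinear (fun x => inf (S x)).
Proof.
move=> infS addS scaleS; split => [x y|].
  have [Sx0 _] := infS x; have [Sy0 _] := infS y.
  rewrite -lerBlDr; apply: lb_le_inf => // a Sa.
  rewrite lerBlDr -lerBlDl; apply: lb_le_inf => // b Sb.
  have [c Sc cab] := addS _ _ _ _ Sa Sb.
  by rewrite lerBlDl (le_trans _ cab)// ge_inf//; case: (infS (x + y)).
(* This inequality for every [t > 0] suffices: used with [t^-1] at [t *: x] it gives the reverse
   one. *)
have leZ t x : 0 < t -> inf (S (t *: x)) <= t * inf (S x).
  move=> t0; rewrite -ler_pdivrMl//; apply: lb_le_inf => [|a Sa].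
    by case: (infS x).
  rewrite ler_pdivrMl// ge_inf//; first by case: (infS (t *: x)).
  exact: scaleS.
move=> t x t0; apply/eqP; rewrite eq_le leZ//=.
rewrite -ler_pdivlMl//.
by rewrite -{1}(scalerK (lt0r_neq0 t0) x) leZ// invr_gt0.
Qed.

(* The directional regularization of a minimal [q] along [a] is again sublinear,
   hence equal to [q], which forces [q (x + a) = q x + q a]. *)
Lemma minimal_sublinear_additive {q} : sublinear q ->
  (forall q', sublinear q' -> (forall x, q' x <= q x) ->
    forall x, q x <= q' x) ->
  forall x y, q (x + y) = q x + q y.
Proof.
move=> sq minq x a; have [qD qZ] := sq.
apply/eqP; rewrite eq_le qD/= -lerBrDr.
have qZ0 t y : 0 <= t -> q (t *: y) = t * q y.
  rewrite le_eqVlt => /predU1P[<-|/qZ//].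
  by rewrite scale0r mul0r sublinear0.
pose S z := [set q (z + t *: a) - t * q a | t in [set t : R | 0 <= t]].
have lbS z : lbound (S z) (- q (- z)).
  move=> _ [t /= t0 <-].
  have := qD (z + t *: a) (- z).
  by rewrite addrAC subrr add0r qZ0// => ?; lra.
have SS : sublinear (fun z => inf (S z)).
  apply: sublinear_inf.
  - move=> z; split; last by exists (- q (- z)).
    by exists (q (z + 0 *: a) - 0 * q a), 0 => /=.
  - move=> z1 z2 _ _ [t1 /= t10 <-] [t2 /= t20 <-].
    exists (q (z1 + z2 + (t1 + t2) *: a) - (t1 + t2) * q a).
      by exists (t1 + t2) => //=; exact: addr_ge0.
    have := qD (z1 + t1 *: a) (z2 + t2 *: a).
    by rewrite addrACA -scalerDl => ?; lra.
  - move=> t z _ t0 [s /= s0 <-]; exists (t * s) => /=.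
      by rewrite mulr_ge0// ltW.
    by rewrite -scalerA -scalerDr qZ// mulrBr mulrA.
have Sle z t : 0 <= t -> inf (S z) <= q (z + t *: a) - t * q a.
  move=> t0; apply: ge_inf; first by exists (- q (- z)).
  by exists t.
have Sq z : inf (S z) <= q z.
  by rewrite (le_trans (Sle z 0 _))// scale0r mul0r addr0 subr0.
(* Minimality puts [q x] below the infimum, which [t = 1] bounds by [q (x + a) - q a]. *)
rewrite (le_trans (minq _ SS Sq x))//.
by rewrite (le_trans (Sle x 1 _))// scale1r mul1r.
Qed.

(** Zorn's lemma among the sublinear minorants of [p]. A chain is bounded by its pointwise infimum,
    finite because every member is at least [- p (- x)] at [x]. *)
Lemma exists_minimal_sublinear {p} : sublinear p ->
  exists q, [/\ sublinear q, forall x, q x <= p x &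
    forall q', sublinear q' -> (forall x, q' x <= q x) ->
      forall x, q x <= q' x].
Proof.
move=> sp; pose T := {q : V -> R | sublinear q /\ forall x, q x <= p x}.
(* The order is reversed: a maximal element is a minimal functional. *)
pose Rel (s t : T) : bool := `[< forall x, sval t x <= sval s x >].
pose mkT q sq qp : T := exist _ q (conj sq qp).
have [||A totA|[q [sq qp]] maxq] :=
    @ZL_preorder T (mkT p sp (fun=> lexx _)) Rel.
- by move=> t; apply/asboolP.
- move=> r s t /asboolP rs /asboolP st; apply/asboolP => x.
  exact: le_trans (st x) (rs x).
(* The infimum needs a nonempty chain; the empty one is bounded by [p]. *)
- have [A0|/set0P[t0 At0]] := eqVneq A set0.
    by exists (mkT p sp (fun=> lexx _)) => s; rewrite A0.
  pose S x := [set sval t x | t in A].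
  have lbS x : has_lbound (S x).
    exists (- p (- x)) => _ [[q [sq qp]] /= _ <-].
    by rewrite (le_trans _ (sublinear_geN x sq))// lerN2.
  have sS : sublinear (fun x => inf (S x)).
    apply: sublinear_inf.
    - by move=> x; split => //; exists (sval t0 x), t0.
    - move=> x y _ _ [s As <-] [t At <-].
      have [/asboolP st|/asboolP ts] := totA _ _ As At.
        exists (sval t (x + y)); first by exists t.
        by rewrite (le_trans ((svalP t).1.1 x y))// lerD2r.
      exists (sval s (x + y)); first by exists s.
      by rewrite (le_trans ((svalP s).1.1 x y))// lerD2l.
    - move=> t x _ t0' [s As <-]; exists s => //.
      by rewrite (svalP s).1.2.
  have Sle t x : A t -> inf (S x) <= sval t x.
    by move=> At; apply: ge_inf => //; exists t.
  have Sp x : inf (S x) <= p x.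
    exact: le_trans (Sle _ _ At0) ((svalP t0).2 x).
  exists (mkT _ sS Sp) => s As; apply/asboolP => x.
  exact: Sle.
- exists q; split => // q' sq' q'q.
  have q'p x : q' x <= p x by exact: le_trans (q'q x) (qp x).
  have /asboolP := maxq (mkT q' sq' q'p) (asboolT q'q).
  by [].
Qed.

(** A minimal sublinear minorant is additive, hence odd, hence homogeneous for scalars of both
    signs. *)
Lemma Hahn_Banach {p} : sublinear p ->
  exists l : {linear V -> R^o}, forall x, l x <= p x.
Proof.
move=> /exists_minimal_sublinear[q [sq qp minq]].
have qD := minimal_sublinear_additive sq minq.
have qN x : q (- x) = - q x.
  by have := qD x (- x); rewrite subrr (sublinear0 sq) => ?; lra.
have qlin : linear (q : V -> R^o).
  move=> t x y; rewrite qD; congr (_ + _).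
  have [t0|t0|->] := ltrgt0P t; first by rewrite sq.2.
    rewrite -[t *: x]opprK -scaleNr qN sq.2 ?oppr_gt0//.
    by rewrite mulNr opprK.
  by rewrite !scale0r sublinear0.
pose qL := GRing.isLinear.Build R V R^o *:%R q qlin.
pose ql : {linear V -> R^o} := HB.pack (q : V -> R^o) qL.
by exists ql.
Qed.

End HahnBanach.

(** * Convexity on a set, directional derivatives and the sum rule *)

Definition convex_on {R : realType} {V : lmodType R} (D : set V) (F : V -> R) :=
  forall x y t, 0 < t < 1 -> D x -> D y ->
    D (t *: x + (1 - t) *: y) /\
    F (t *: x + (1 - t) *: y) <= t * F x + (1 - t) * F y.

Definition subgradient {R : realType} {V : lmodType R} (D : set V) (F : V -> R)
  (x : V) (p : V -> R) := forall y, D y -> p (y - x) <= F y - F x.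

Section ConvexOn.
Context {R : realType} {V : lmodType R} {D : set V}.
Implicit Types (F G : V -> R) (x y z h : V) (a b s t : R).

(** Convexity with unnormalised weights; membership of [z] comes along because [convex_on] includes
    convexity of [D]. *)
Lemma convex_on_comb {F x y z a b} : convex_on D F -> 0 < a -> 0 < b ->
  D x -> D y -> (a + b) *: z = a *: x + b *: y ->
  D z /\ (a + b) * F z <= a * F x + b * F y.
Proof.
move=> cF a0 b0 Dx Dy zE; have ab0 : 0 < a + b by exact: addr_gt0.
have abn0 : a + b != 0 by rewrite lt0r_neq0.
have b1 : 1 - a / (a + b) = b / (a + b) by field.
have -> : z = (a / (a + b)) *: x + (1 - a / (a + b)) *: y.
  rewrite b1 -[z](scalerK abn0) zE scalerDr !scalerA.
  by rewrite ![(a + b)^-1 * _]mulrC.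
have [|||Dz] := cF x y (a / (a + b)) => //.
  by rewrite divr_gt0// ltr_pdivrMr// mul1r ltrDl.
rewrite -(ler_pM2l ab0) => Fz; split => //; apply: (le_trans Fz).
by rewrite le_eqVlt; rewrite b1; apply/orP; left; apply/eqP; field.
Qed.

(** The point at step [s] combines [x + t *: h] and [x] with weights [s] and [t - s], so slopes are
    nondecreasing in the step. *)
Lemma convex_slope {F x h s t} : convex_on D F -> D x -> 0 < s <= t ->
  D (x + t *: h) ->
  D (x + s *: h) /\ (F (x + s *: h) - F x) / s <= (F (x + t *: h) - F x) / t.
Proof.
move=> cF Dx /andP[s0]; rewrite le_eqVlt => /predU1P[->//|st] Dxt.
have t0 : 0 < t by exact: lt_trans st.
have [||||] := @convex_on_comb F (x + t *: h) x (x + s *: h) s (t - s) cF s0 => //.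
- by rewrite subr_gt0.
- rewrite subrKC !scalerDr !scalerA mulrC addrAC -scalerDl.
  by rewrite subrKC.
- rewrite subrKC => Dxs Fs; split => //.
  rewrite ler_pdivrMr// mulrAC ler_pdivlMr//.
  by rewrite mulrC [_ * s]mulrC; lra.
Qed.

Definition slopes F x h : set R :=
  [set (F (x + t *: h) - F x) / t | t in [set t | 0 < t /\ D (x + t *: h)]].

(** For convex [F] at an algebraic interior point, monotonicity of slopes makes this the one-sided
    limit; the infimum form fits [sublinear_inf]. *)
Definition dir_deriv F x h := inf (slopes F x h).

Section Directional.
Context (F : V -> R) (x : V).
Hypothesis cF : convex_on D F.
Hypothesis corex : forall h, exists2 t, 0 < t & D (x + t *: h).

(** Some step backwards stays in [D]; by convexity its negated slope bounds all forward slopes from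
    below. *)
Lemma has_inf_slopes h : has_inf (slopes F x h).
Proof.
split; first by have [t t0 Dt] := corex h; eexists; exists t.
have [s s0 Ds] := corex (- h).
exists (- ((F (x + s *: - h) - F x) / s)) => _ [t [t0 Dt] <-].
have [|] := convex_on_comb cF s0 t0 Dt Ds (z := x).
  rewrite !scalerDr !scalerA addrACA -scalerDl [t * s]mulrC scalerN subrr.
  by rewrite addr0.
move=> _ Fx; rewrite -mulNr ler_pdivrMr// mulrAC ler_pdivlMr//.
by rewrite mulrC [_ * s]mulrC; lra.
Qed.

Lemma dir_deriv_le h t : 0 < t -> D (x + t *: h) ->
  dir_deriv F x h <= (F (x + t *: h) - F x) / t.
Proof.
move=> t0 Dt; apply: ge_inf; first by case: (has_inf_slopes h).
by exists t.
Qed.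

Lemma sublinear_dir_deriv : sublinear (dir_deriv F x).
Proof.
apply: sublinear_inf; first exact: has_inf_slopes.
- move=> h k _ _ [s [s0 Ds] <-] [t [t0 Dt] <-].
  (* With this step, [x + r *: (h + k)] is the combination of [x + s *: h] and [x + t *: k] with
     weights proportional to [t] and [s]. *)
  pose r := s * t / (s + t).
  have st0 : 0 < s + t by exact: addr_gt0.
  have stn0 : s + t != 0 by rewrite lt0r_neq0.
  have r0 : 0 < r by rewrite divr_gt0 ?mulr_gt0.
  have [|Dr Fr] := convex_on_comb cF t0 s0 Ds Dt (z := x + r *: (h + k)).
    rewrite !scalerDr !scalerA [t + s]addrC mulrCA mulfV// mulr1.
    by rewrite addrACA -scalerDl [t + s]addrC [t * s]mulrC.
  exists ((F (x + r *: (h + k)) - F x) / r); first by exists r.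
  rewrite ler_pdivrMr//.
  have -> : ((F (x + s *: h) - F x) / s + (F (x + t *: k) - F x) / t) * r =
      (t * (F (x + s *: h) - F x) + s * (F (x + t *: k) - F x)) / (s + t).
    by rewrite /r; field; rewrite stn0 !lt0r_neq0.
  by rewrite ler_pdivlMr// mulrC; lra.
- move=> t h _ t0 [s [s0 Ds] <-]; exists (s / t).
    by split; rewrite ?divr_gt0// scalerA divfK ?lt0r_neq0.
  rewrite scalerA divfK ?lt0r_neq0//.
  by field; rewrite !lt0r_neq0.
Qed.

Lemma subgradient_dir_deriv (p : V -> R) :
  (forall h, p h <= dir_deriv F x h) -> subgradient D F x p.
Proof.
move=> pF y Dy; apply: (le_trans (pF _)).
have := @dir_deriv_le (y - x) 1 ltr01.
by rewrite scale1r subrKC divr1; exact.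
Qed.

Lemma exists_subgradient :
  exists p : {linear V -> R^o}, subgradient D F x p.
Proof.
have [p pF] := Hahn_Banach sublinear_dir_deriv.
by exists p; exact: subgradient_dir_deriv.
Qed.

End Directional.

(* The infimal convolution [q] of the two directional derivatives is sublinear
   because their sum is nonnegative; any linear [p <= q] then works. *)
Lemma subgradient_sum_min {F G x} : convex_on D F -> convex_on D G -> D x ->
  (forall h, exists2 t, 0 < t & D (x + t *: h)) ->
  (forall y, D y -> F x + G x <= F y + G y) ->
  exists p : {linear V -> R^o},
    subgradient D F x p /\ subgradient D G x (fun h => - p h).
Proof.
move=> cF cG Dx corex minx.
have sF := sublinear_dir_deriv F x cF corex.
have sG := sublinear_dir_deriv G x cG corex.
set F' := dir_deriv F x in sF; set G' := dir_deriv G x in sG.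
(* Slopes of the two functions may use different steps: the longer one is shortened by
   [convex_slope], then minimality applies at the common step. Generic [F1] and [G1] allow either
   function to have the longer step. *)
have slope_le F1 G1 h s t : convex_on D G1 ->
    (forall y, D y -> F1 x + G1 x <= F1 y + G1 y) ->
    0 < s <= t -> D (x + t *: h) ->
    - ((G1 (x + t *: h) - G1 x) / t) <= (F1 (x + s *: h) - F1 x) / s.
  move=> cG1 minx1 st Dt; have [Ds] := convex_slope cG1 Dx st Dt.
  have /andP[s0 _] := st.
  rewrite lerNl; apply: le_trans; rewrite -mulNr ler_pM2r ?invr_gt0//.
  by have := minx1 _ Ds; lra.
have FG h : 0 <= F' h + G' h.
  rewrite -lerBlDr; apply: lb_le_inf => [|_ [s [s0 Ds] <-]].
    by case: (has_inf_slopes F x cF corex h).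
  rewrite lerBlDr -lerBlDl; apply: lb_le_inf => [|_ [t [t0 Dt] <-]].
    by case: (has_inf_slopes G x cG corex h).
  rewrite sub0r lerNl; have [st|/ltW ts] := leP s t.
    by apply: slope_le; rewrite ?s0// => y Dy; exact: minx.
  rewrite lerNl; apply: slope_le; rewrite ?t0// => y Dy.
  by rewrite [G x + _]addrC [G y + _]addrC; exact: minx.
pose S h := [set F' (h + u) + G' u | u in [set: V]].
have sS : sublinear (fun h => inf (S h)).
  apply: sublinear_inf.
  - move=> h; split; first by eexists; exists 0.
    exists (- F' (- h)) => _ [u _ <-].
    have := sF.1 (h + u) (- h); rewrite addrAC subrr add0r.
    by have := FG u; lra.
  - move=> h k _ _ [u _ <-] [v _ <-].
    exists (F' ((h + k) + (u + v)) + G' (u + v)); first by exists (u + v).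
    have := sF.1 (h + u) (k + v); have := sG.1 u v.
    by rewrite addrACA; lra.
  - move=> t h _ t0 [u _ <-]; exists (t *: u) => //.
    by rewrite -scalerDr sF.2// sG.2// mulrDr.
have [p pS] := Hahn_Banach sS.
have pFG h u : p h <= F' (h + u) + G' u.
  apply: (le_trans (pS h)); apply: ge_inf; last by exists u.
  exists (- F' (- h)) => _ [v _ <-].
  have := sF.1 (h + v) (- h); rewrite addrAC subrr add0r.
  by have := FG v; lra.
(* [u = 0] gives [p <= F']; the pair [- h], [u = h] gives [- p <= G']. *)
exists p; split; apply: subgradient_dir_deriv => // h.
  by have := pFG h 0; rewrite addr0 (sublinear0 sG) addr0.
by have := pFG (- h) h; rewrite addNr (sublinear0 sF) add0r linearN.
Qed.

End ConvexOn.

(** * Norm estimates and completeness of the dual space *)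

Section Dual.
Context {R : realType} {E : normedModType R}.
Implicit Types (p : dual E) (h : E).

Lemma dual_eval_le p h : `|p h| <= `|p| * `|h|.
Proof.
have [->|h0] := eqVneq h 0; first by rewrite linear0 !normr0 mulr0.
have nh : 0 < `|h| by rewrite normr_gt0.
have /(dual_norm_ub p) : `| `|h|^-1 *: h| <= 1.
  by rewrite normrZ normfV normr_id mulVf// lt0r_neq0.
by rewrite linearZ normrZ normfV normr_id mulrC ler_pdivrMr.
Qed.

Lemma dual_norm_le_bound p M : 0 <= M ->
  (forall h, `|p h| <= M * `|h|) -> `|p| <= M.
Proof.
move=> M0 pM; apply: dual_norm_le => h h1.
by rewrite (le_trans (pM h))// ler_piMr.
Qed.

Lemma dual_of_bounded {l : {linear E -> R^o}} {M} :
  (forall h, `|l h| <= M * `|h|) -> exists p : dual E, forall h, p h = l h.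
Proof.
move=> lM; have cl : continuous l.
  apply: bounded_linear_continuous; apply/linear_boundedP.
  exists M; split; first exact: num_real.
  move=> N MN h; rewrite (le_trans (lM h))// ler_wpM2r//.
  exact: ltW.
have cll : (l : E -> R^o) \in @cont_linear R E.
  by apply/asboolP; split => //; exact: linearP.
by exists (Dual cll).
Qed.

(** The subgradient is tested at [y] plus or minus a vector along [h] of length [r / 2], strictly
    inside the ball. This yields norm estimates and also the continuity that Hahn-Banach alone does
    not give. *)
Lemma subgradient_bound {D : set E} {F : E -> R} {l : {linear E -> R^o}} {y r e} :
  0 < r -> (forall z, `|z - y| < r -> D z /\ F z - F y <= e) ->
  subgradient D F y l -> forall h, `|l h| <= 2 * e / r * `|h|.
Proof.
move=> r0 Fe lF h.
have [->|h0] := eqVneq h 0; first by rewrite linear0 !normr0 mulr0.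
have nh : 0 < `|h| by rewrite normr_gt0.
pose c := r / 2 / `|h|.
have c0 : 0 < c by rewrite !divr_gt0.
have le1 k : `|k| = `|h| -> c * l k <= e.
  move=> kh; have [|Dz Fz] := Fe (y + c *: k).
    rewrite addrAC subrr add0r normrZ kh gtr0_norm// /c divfK ?lt0r_neq0//.
    by rewrite ltr_pdivrMr// ltr_pMr// ltr1n.
  apply: le_trans Fz; have := lF _ Dz.
  by rewrite addrAC subrr add0r linearZ.
have -> : 2 * e / r * `|h| = e / c.
  by rewrite /c; field; rewrite !lt0r_neq0.
rewrite ler_pdivlMr// mulrC.
have [l0|l0] := leP 0 (l h); first by rewrite ger0_norm// le1.
rewrite ltr0_norm//; have := le1 (- h); rewrite normrN => /(_ erefl).
by rewrite linearN.
Qed.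

Lemma cvg_dual_eval {T} {F : set_system T} {FF : Filter F} (u : T -> dual E)
  p h : u @ F --> p -> (fun t => u t h : R^o) @ F --> (p h : R^o).
Proof.
move=> up; apply/cvgrPdist_le => e e0.
have d0 : 0 < e / (`|h| + 1) by rewrite divr_gt0// ltr_wpDl.
have /cvgrPdist_le/(_ _ d0) := up; apply: filterS => t.
rewrite ler_pdivlMr ?ltr_wpDl// => pt.
have -> : p h - u t h = (p - u t) h by [].
rewrite (le_trans (dual_eval_le _ _))// (le_trans _ pt)// ler_wpM2l//.
by rewrite lerDl.
Qed.

(** Pointwise limits define a linear [l]. The Cauchy estimate passes to the limit as [e * |h|],
    which makes [l] bounded and the convergence one in norm. *)
Lemma dual_complete (F : set_system (dual E)) : ProperFilter F ->
  cauchy F -> cvg F.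
Proof.
move=> FF /cauchyP cF.
have ev x : cvg ((fun p : dual E => p x : R^o) @ F).
  apply/cauchy_cvgP/cauchyP => e e0.
  have d0 : 0 < e / (`|x| + 1) by rewrite divr_gt0// ltr_wpDl.
  have [p Fp] := cF _ d0; exists (p x).
  suff : F [set q : dual E | ball (p x : R^o) e (q x)] by [].
  apply: filterS Fp => q.
  rewrite -!ball_normE/= ltr_pdivlMr ?ltr_wpDl// => pq.
  have -> : p x - q x = (p - q) x by [].
  rewrite (le_lt_trans (dual_eval_le _ _))// (le_lt_trans _ pq)// ler_wpM2l//.
  by rewrite lerDl.
pose l x : R^o := lim ((fun p : dual E => p x : R^o) @ F).
have lev x : (fun p : dual E => p x : R^o) @ F --> l x by exact: ev.
have llin : linear l.
  move=> t x y; apply: cvg_lim => //.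
  rewrite (_ : (fun p : dual E => _) = (fun p : dual E => t *: p x + p y)).
    by apply: cvgD => //; apply: cvgZl_tmp.
  by apply/funext => p; rewrite linearP.
pose lL := GRing.isLinear.Build R E R^o *:%R l llin.
pose ll : {linear E -> R^o} := HB.pack l lL.
have near_l e : 0 < e -> exists p, F (ball p e) /\
    forall h, `|l h - p h| <= e * `|h|.
  move=> e0; have [p Fp] := cF _ e0; exists p; split => // h.
  apply: (@ler_cvg_to _ F _ R (fun q : dual E => `|q h - p h|) (fun=> e * `|h|)).
  - by apply: cvg_norm; apply: cvgB => //; exact: cvg_cst.
  - exact: cvg_cst.
  - apply: filterS Fp => q; rewrite -ball_normE/= distrC => /ltW pq.
    have -> : q h - p h = (q - p) h by [].
    by rewrite (le_trans (dual_eval_le _ _))// ler_wpM2r.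
have [p1 [_ p1l]] := near_l 1 ltr01.
have [|q ql] := @dual_of_bounded ll (1 + `|p1|).
  move=> h; rewrite mulrDl -[ll h](subrK (p1 h)) (le_trans (ler_normD _ _))//.
  by rewrite lerD// dual_eval_le.
apply/cvg_ex; exists q; apply/cvgrPdist_le => e e0.
have e20 : 0 < e / 2 by rewrite divr_gt0.
have [p [Fp pl]] := near_l _ e20.
apply: filterS Fp => r; rewrite -ball_normE/= => pr.
rewrite [e]splitr (le_trans (ler_distD p _ _))// lerD//; last exact: ltW.
apply: dual_norm_le_bound; first exact: ltW.
move=> h; have -> : (q - p) h = l h - p h by rewrite -[l h](ql h).
exact: pl.
Qed.

End Dual.

Lemma ball_core {R : realType} {E : normedModType R} {D : set E} {x : E} {r : R} :
  0 < r -> (forall y, `|y - x| < r -> D y) ->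
  forall h, exists2 t, 0 < t < 1 & D (x + t *: h).
Proof.
move=> r0 ballx h; have h1 : 0 < `|h| + 1 by rewrite ltr_wpDl.
have rh0 : 0 < r + (`|h| + 1) by rewrite addr_gt0.
(* This step is below [1] and moves [x] by less than [r], even for [h = 0]. *)
exists (r / (r + (`|h| + 1))).
  by rewrite divr_gt0//= ltr_pdivrMr// mul1r ltrDl.
apply: ballx; rewrite addrAC subrr add0r normrZ gtr0_norm ?divr_gt0//.
rewrite mulrAC ltr_pdivrMr// ltr_pM2l// addrCA ltrDl.
exact: addr_gt0.
Qed.

(** * Remainders of a convergent series of convex functions *)

Definition rest {R : realType} {E : Type} (f : E -> R) (f_ : nat -> E -> R)
  (n : nat) (x : E) : R := f x - \sum_(0 <= k < n) f_ k x.

Section ConvexSeries.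
Context {R : realType} {E : normedModType R} {D : set E}.
Context {f : E -> R} {f_ : nat -> E -> R}.
Hypothesis convex_f_ : forall k, convex_on D (f_ k).
Hypothesis cvg_f_ :
  forall x, D x -> (fun n => \sum_(0 <= k < n) f_ k x) @ \oo --> f x.
Notation g := (rest f f_).
Implicit Types (x y z : E) (n m : nat).

Lemma rest_sub n m x : (n <= m)%N ->
  g n x - g m x = \sum_(n <= k < m) f_ k x.
Proof.
by move=> nm; rewrite /rest (big_cat_nat _ nm)//=; ring.
Qed.

Lemma rest0 x : g 0 x = f x.
Proof. by rewrite /rest big_geq// subr0. Qed.

Lemma rest_cvg0 x : D x -> (fun n => g n x) @ \oo --> 0.
Proof.
by move=> Dx; rewrite -(subrr (f x)); apply: cvgB; [exact: cvg_cst|exact: cvg_f_].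
Qed.

Lemma rest_cvg n x : D x ->
  (fun m => \sum_(n <= k < m) f_ k x) @ \oo --> g n x.
Proof.
move=> Dx; rewrite -[g n x]subr0.
apply: cvg_trans (cvgB (cvg_cst (g n x)) (rest_cvg0 x Dx)).
apply: near_eq_cvg; near=> m; rewrite -rest_sub//.
by near: m; exact: nbhs_infty_ge.
Unshelve. all: by end_near. Qed.

(** The remainder is a pointwise limit of the convex finite sums [f_n + ... + f_(m-1)]. *)
Lemma convex_rest n : convex_on D (g n).
Proof.
(* The term of index [0] serves only to give convexity of [D]. *)
move=> x y t t01 Dx Dy; have [Dz _] := convex_f_ 0 x y t t01 Dx Dy.
split => //; apply: (ler_cvg_to (rest_cvg n _ Dz)).
  by apply: cvgD; apply: cvgMr; exact: rest_cvg.
apply: nearW => m; rewrite !fctE !mulr_sumr -big_split/=.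
by apply: ler_sum => k _; case: (convex_f_ k x y t t01 Dx Dy).
Qed.

Definition rest_small (N : nat) (e : R) (x : E) (r : R) :=
  forall n y, (N <= n)%N -> `|y - x| < r -> `|g n y| <= e.

Definition rest_unif_cvg0 (x : E) (r : R) :=
  [/\ 0 < r, forall y, `|y - x| < r -> D y &
      forall e, 0 < e -> exists N, rest_small N e x r].

(* For [y] near [x], [y] lies on a segment from the fixed point
   [z = x + s (x - u)] of [D] to the ball around [u]: convexity bounds [g n y]
   from above.  Reflecting [y] in [x] gives the lower bound. *)
Lemma rest_unif_cvg0_interior {u d x r} : rest_unif_cvg0 u d -> 0 < r ->
  (forall y, `|y - x| < r -> D y) -> exists r', rest_unif_cvg0 x r'.
Proof.
move=> [d0 ballu smallu] r0 ballx.
(* Small enough to keep [z] in the [r]-ball around [x]; adding [1] covers [x = u]. *)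
pose s := r / (`|x - u| + 1).
have nxu0 : 0 < `|x - u| + 1 by rewrite ltr_wpDl.
have s0 : 0 < s by rewrite divr_gt0.
have s10 : 0 < 1 + s by rewrite addr_gt0.
pose z := x + s *: (x - u).
have Dz : D z.
  apply: ballx; rewrite addrAC subrr add0r normrZ gtr0_norm// /s.
  by rewrite mulrAC ltr_pdivrMr// ltr_pM2l// ltrDl.
have Dx : D x by apply: ballx; rewrite subrr normr0.
(* The second bound keeps the point [v] with [(1 + s) y = z + s v] in the [d]-ball around [u]. *)
pose r' := Num.min r (d * s / (1 + s)).
have r'r : r' <= r by rewrite ge_min lexx.
have r'd : r' <= d * s / (1 + s) by rewrite ge_min lexx orbT.
exists r'; split.
- by rewrite lt_min r0 divr_gt0// mulr_gt0.
- by move=> y yr; apply: ballx; exact: lt_le_trans r'r.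
(* Thirds, because reflection gives [g n y >= 2 * g n x - g n y'] with [y'] the mirror image of [y],
   hence at least [- e]. *)
move=> e e0; have e30 : 0 < e / 3 by rewrite divr_gt0.
have [N1 smallN1] := smallu _ e30.
have cvgz y : D y -> exists N, forall n, (N <= n)%N -> `|g n y| <= e / 3.
  move=> Dy; have /cvgrPdist_le/(_ _ e30)[N _ NP] := rest_cvg0 y Dy.
  by exists N => n /NP/=; rewrite sub0r normrN.
have [N2 smallN2] := cvgz _ Dz; have [N3 smallN3] := cvgz _ Dx.
exists (maxn N1 (maxn N2 N3)) => n y; rewrite !geq_max => /and3P[N1n N2n N3n] yr.
have up y' : `|y' - x| < r' -> g n y' <= e / 3.
  move=> y'r; pose v := u + ((1 + s) / s) *: (y' - x).
  have vu : `|v - u| < d.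
    rewrite addrAC subrr add0r normrZ gtr0_norm ?divr_gt0//.
    by rewrite mulrC -ltr_pdivlMr ?divr_gt0// invf_div mulrA (lt_le_trans y'r).
  have [|_] := convex_on_comb (convex_rest n) ltr01 s0 Dz (ballu _ vu) (z := y').
    have -> : z = (1 + s) *: x - s *: u.
      by rewrite /z scalerDl scale1r scalerBr addrA.
    rewrite /v scale1r scalerDr scalerA [s * _]mulrC divfK ?lt0r_neq0//.
    by rewrite scalerBr addrA subrK subrKC.
  have := smallN1 n _ N1n vu; have := smallN2 n N2n.
  rewrite mul1r => /(le_trans (ler_norm _)) gz /(le_trans (ler_norm _)) gv gy.
  rewrite -(ler_pM2l s10) (le_trans gy)// mulrDl mul1r lerD//.
  by rewrite ler_pM2l.
have yr' : `|(x - (y - x)) - x| < r' by rewrite addrAC subrr add0r normrN.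
have Dy : D y by apply: ballx; exact: lt_le_trans r'r.
have Dy' : D (x - (y - x)) by apply: ballx; exact: lt_le_trans r'r.
have [|_] := convex_on_comb (convex_rest n) ltr01 ltr01 Dy Dy' (z := x).
  by rewrite !scale1r scalerDl scale1r opprB addrCA subrKC.
have := up _ yr; have := up _ yr'; have := smallN3 n N3n.
by rewrite !ler_norml; lra.
Qed.

Lemma dual_sumE n m (p_ : nat -> dual E) h :
  (\sum_(n <= k < m) p_ k) h = \sum_(n <= k < m) p_ k h.
Proof. exact: (big_morph (fun p : dual E => p h : R)). Qed.

Lemma subgradient_sum {n m x} {p_ : nat -> dual E} : (n <= m)%N ->
  (forall k, (n <= k)%N -> subgradient D (f_ k) x (p_ k)) ->
  subgradient D (fun y => g n y - g m y) x (\sum_(n <= k < m) p_ k : dual E).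
Proof.
move=> nm px y Dy; rewrite dual_sumE !rest_sub// -sumrB.
by apply: ler_sum_nat => k /andP[nk _]; exact: px.
Qed.

(** The inequality for finite sums passes to the limit at each fixed point of [D]. *)
Lemma subgradient_sums_to {n y} {p_ : nat -> dual E} {s : dual E} : D y ->
  (forall k, (n <= k)%N -> subgradient D (f_ k) y (p_ k)) ->
  sums_to n p_ s -> subgradient D (g n) y s.
Proof.
move=> Dy py ps z Dz.
have cvg_g := cvgB (rest_cvg n _ Dz) (rest_cvg n _ Dy).
apply: (ler_cvg_to (cvg_dual_eval _ _ (z - y) ps) (cvg_g _)).
near=> m; have nm : (n <= m)%N by near: m; exact: nbhs_infty_ge.
by have := subgradient_sum nm py z Dz; rewrite !rest_sub.
Unshelve. all: by end_near. Qed.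

(** * Subgradients near a point of uniform convergence *)

Section Near.
Context {x : E} {r : R}.
Hypothesis unif_x : rest_unif_cvg0 x (2 * r).

Let r0 : 0 < r.
Proof. by case: unif_x; rewrite pmulr_rgt0. Qed.

(** The reason for the radius [2 * r]: every [y] within [r] of [x] has its own [r]-ball where the
    remainders are small, so estimates are uniform in [y]. *)
Let in_ball {y z} : `|y - x| < r -> `|z - y| < r -> `|z - x| < 2 * r.
Proof.
move=> yx zy; rewrite (le_lt_trans (ler_distD y _ _))//.
by rewrite mulr_natl mulr2n ltrD.
Qed.

Let in_ball_self {y} : `|y - x| < r -> `|y - x| < 2 * r.
Proof. by move/in_ball; apply; rewrite subrr normr0. Qed.

(** An increment of [g n - g m] involves four values of size at most [e], so [subgradient_bound]
    applies with [4 * e]. *)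
Lemma norm_partial_sum_le {N e n m y} {p_ : nat -> dual E} :
  rest_small N e x (2 * r) -> 0 < e -> (N <= n <= m)%N -> `|y - x| < r ->
  (forall k, (n <= k)%N -> subgradient D (f_ k) y (p_ k)) ->
  `|\sum_(n <= k < m) p_ k| <= 8 * e / r.
Proof.
move=> small e0 /andP[Nn nm] yx py.
apply: dual_norm_le_bound; first by rewrite divr_ge0 ?mulr_ge0// ltW.
have -> : 8 * e / r = 2 * (4 * e) / r by rewrite mulrA -natrM.
apply: subgradient_bound (subgradient_sum nm py) => // z zy.
have zx := in_ball yx zy; split; first by case: unif_x => _ + _; apply.
have Nm := leq_trans Nn nm; have yx2 := in_ball_self yx.
have := small _ _ Nn zx; have := small _ _ Nm zx.
have := small _ _ Nn yx2; have := small _ _ Nm yx2.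
by rewrite !ler_norml; lra.
Qed.

(** As before, with only two values of size [e]. *)
Lemma norm_subgradient_rest_le {N e n y} {p : dual E} :
  rest_small N e x (2 * r) -> 0 < e -> (N <= n)%N -> `|y - x| < r ->
  subgradient D (g n) y p -> `|p| <= 4 * e / r.
Proof.
move=> small e0 Nn yx py.
apply: dual_norm_le_bound; first by rewrite divr_ge0 ?mulr_ge0// ltW.
have -> : 4 * e / r = 2 * (2 * e) / r by rewrite mulrA -natrM.
apply: subgradient_bound py => // z zy.
have zx := in_ball yx zy; split; first by case: unif_x => _ + _; apply.
have := small _ _ Nn zx; have := small _ _ Nn (in_ball_self yx).
by rewrite !ler_norml; lra.
Qed.

Lemma summable_subgradients {n y} {p_ : nat -> dual E} : `|y - x| < r ->
  (forall k, (n <= k)%N -> subgradient D (f_ k) y (p_ k)) ->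
  exists s : dual E, sums_to n p_ s.
Proof.
move=> yx py; have [_ _ smallx] := unif_x.
apply/cvg_ex; apply: dual_complete; apply: cauchy_exP => e e0.
(* Chosen so that the bound [8 * _ / r] on blocks equals [e / 2]. *)
have e160 : 0 < e * r / 16 by rewrite divr_gt0// mulr_gt0.
have [N small] := smallx _ e160.
exists (\sum_(n <= k < maxn N n) p_ k).
exists (maxn N n) => // m /= Nm; rewrite -ball_normE/= distrC.
rewrite (big_cat_nat _ Nm) ?leq_maxr//= addrAC subrr add0r.
have /le_lt_trans -> // : `|\sum_(maxn N n <= k < m) p_ k| <= e / 2.
  have -> : e / 2 = 8 * (e * r / 16) / r by field; rewrite lt0r_neq0.
  apply: (norm_partial_sum_le small e160 _ yx); first by rewrite leq_maxl.
  by move=> k nk; apply: py; rewrite (leq_trans _ nk)// leq_maxr.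
by rewrite ltr_pdivrMr// ltr_pMr// ltr1n.
Qed.

Hypothesis bounded_f_ : forall k, exists t e, 0 < t /\
  forall z, `|z - x| < t -> D z /\ f_ k z - f_ k x <= e.

Let Dx : D x.
Proof.
by case: unif_x => r2 ballx _; apply: ballx; rewrite subrr normr0.
Qed.

Let corex h : exists2 t, 0 < t & D (x + t *: h).
Proof.
case: unif_x => r2 ballx _; have [t /andP[t0 _] Dt] := ball_core r2 ballx h.
by exists t.
Qed.

(** A local upper bound on [f_ k] suffices to make an algebraic subgradient continuous. *)
Let dual_of_subgradient {k} {l : {linear E -> R^o}} :
  subgradient D (f_ k) x l -> exists p : dual E, forall h, p h = l h.
Proof.
have [t [e [t0 bd]]] := bounded_f_ k.
by move=> /(subgradient_bound t0 bd)/dual_of_bounded.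
Qed.

Lemma exists_dual_subgradient k : exists p : dual E, subgradient D (f_ k) x p.
Proof.
have [l lx] := exists_subgradient (f_ k) x (convex_f_ k) corex.
have [p pl] := dual_of_subgradient lx.
by exists p => y Dy; rewrite pl; exact: lx.
Qed.

(** The hypothesis says that [x] minimizes [f_ n + (g n.+1 - s)] on [D]. The sum rule gives [l] for
    [f_ n] and [- l] for [g n.+1 - s]; continuity of [l] comes from [f_ n]. *)
Lemma split_subgradient {n} {s : dual E} : subgradient D (g n) x s ->
  exists p : dual E, subgradient D (f_ n) x p /\
    subgradient D (g n.+1) x (s - p : dual E).
Proof.
move=> sx; pose G z := g n.+1 z - s z.
have cG : convex_on D G.
  move=> y z t t01 Dy Dz; have [Dw gw] := convex_rest n.+1 y z t t01 Dy Dz.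
  split => //; rewrite /G linearD 2!linearZ/= /GRing.scale/=; lra.
have gE y : g n y = f_ n y + g n.+1 y.
  by rewrite -[LHS](subrK (g n.+1 y)) rest_sub// big_nat1.
have [|l [lf lG]] := subgradient_sum_min (convex_f_ n) cG Dx corex.
  move=> y Dy; have := sx y Dy; rewrite !gE /G linearB/=; lra.
have [p pl] := dual_of_subgradient lf.
exists p; split => y Dy; first by rewrite pl; exact: lf.
have -> : (s - p : dual E) (y - x) = s (y - x) - l (y - x) by rewrite -pl.
by have := lG y Dy; rewrite /G linearB/=; lra.
Qed.

(* Split [g 0 = f_ 0 + g 1], then [g 1 = f_ 1 + g 2], and so on: the remainder
   after [n] steps is a subgradient of [g n], hence small in norm. *)
Lemma decompose_subgradient {s : dual E} : subgradient D (g 0) x s ->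
  exists p_ : nat -> dual E,
    (forall k, subgradient D (f_ k) x (p_ k)) /\ sums_to 0 p_ s.
Proof.
move=> sx.
(* The subgradient condition is a premise, so the choice function is total, with default [0]. *)
have /choice[c cP] : forall ns : nat * dual E, exists p : dual E,
    subgradient D (g ns.1) x ns.2 -> subgradient D (f_ ns.1) x p /\
      subgradient D (g ns.1.+1) x (ns.2 - p : dual E).
  move=> [n q]/=; have [/split_subgradient[p pP]|nq] :=
    pselect (subgradient D (g n) x q); by [exists p|exists 0].
(* [s_ n] is what remains of [s] after removing the first [n] chosen subgradients. *)
pose s_ := fix s_ n := if n is m.+1 then s_ m - c (m, s_ m) else s.
have s_P n : subgradient D (g n) x (s_ n).
  by elim: n => // n IH; have [] := cP (n, s_ n) IH.
have sumE n : \sum_(0 <= k < n) c (k, s_ k) = s - s_ n.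
  elim: n => [|n IH]; first by rewrite big_geq// subrr.
  by rewrite big_nat_recr//= IH opprB addrA addrAC.
exists (fun k => c (k, s_ k)); split.
  by move=> k; have [] := cP (k, s_ k) (s_P k).
apply/cvgrPdist_le => e e0; have [_ _ smallx] := unif_x.
have e40 : 0 < e * r / 4 by rewrite divr_gt0// mulr_gt0.
have [N small] := smallx _ e40; exists N => // n /= Nn.
rewrite sumE opprB addrC subrK.
have -> : e = 4 * (e * r / 4) / r by field; rewrite lt0r_neq0.
apply: (norm_subgradient_rest_le small e40 Nn _ (s_P n)).
by rewrite subrr normr0.
Qed.

End Near.
End ConvexSeries.

(** * From extended-real functions to real functions on the domain *)

Section Transfer.
Context {R : realType} {E : normedModType R}.
Implicit Types (F : E -> \bar R) (x y : E).

Lemma dom_fin_num {F x} : proper_convex F -> dom F x -> F x \is a fin_num.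
Proof. by move=> [Fny _ _] Fx; rewrite fin_numE Fny/= lt_eqF. Qed.

Lemma fine_convex_on {F} {D : set E} : proper_convex F -> D `<=` dom F ->
  (forall x y t, 0 < t < 1 -> D x -> D y -> D (t *: x + (1 - t) *: y)) ->
  convex_on D (fine \o F).
Proof.
move=> pF DF cD x y t t01 Dx Dy; have Dz := cD x y t t01 Dx Dy.
split => //=; have [_ _ /(_ x y t t01)] := pF.
rewrite -(fineK (dom_fin_num pF (DF _ Dz))) -(fineK (dom_fin_num pF (DF _ Dx))).
by rewrite -(fineK (dom_fin_num pF (DF _ Dy))) -!EFinM -EFinD lee_fin.
Qed.

Lemma convex_dom {F} : proper_convex F ->
  forall x y t, 0 < t < 1 -> dom F x -> dom F y -> dom F (t *: x + (1 - t) *: y).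
Proof.
move=> pF x y t t01 Fx Fy; have [_ _ /(_ x y t t01) Fz] := pF.
apply: le_lt_trans Fz _.
rewrite -(fineK (dom_fin_num pF Fx)) -(fineK (dom_fin_num pF Fy)).
by rewrite -!EFinM -EFinD ltry.
Qed.

(** Subgradients on [D] are global: for [y] in [dom F], a point of the segment from [x] to [y] near
    [x] lies in [D], and convexity carries the inequality to [y]. Where [F y] is infinite it is
    trivial. *)
Lemma subdiffP {F} {D : set E} {x r} {p : dual E} : proper_convex F ->
  D `<=` dom F -> 0 < r -> (forall y, `|y - x| < r -> D y) ->
  subdiff F x p <-> subgradient D (fine \o F) x p.
Proof.
move=> pF DF r0 ballx.
have Fx : dom F x by apply/DF/ballx; rewrite subrr normr0.
have fx := fineK (dom_fin_num pF Fx).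
split=> [[_ Fp] y Dy|Fp].
  have := Fp y; rewrite -fx -(fineK (dom_fin_num pF (DF _ Dy))).
  by rewrite -EFinB lee_fin.
split => // y; have [Fy|] := pselect (dom F y); last first.
  move=> /negP; rewrite -leNgt leye_eq => /eqP ->.
  by rewrite -fx addye// leey.
have fy := fineK (dom_fin_num pF Fy).
have [t t01 Dz] := ball_core r0 ballx (y - x); have /andP[t0 _] := t01.
have zE : x + t *: (y - x) = t *: y + (1 - t) *: x.
  by rewrite scalerBr scalerBl scale1r addrCA.
rewrite -fx -fy -EFinB lee_fin -(ler_pM2l t0).
have := Fp _ Dz; rewrite addrAC subrr add0r linearZ/= => /le_trans; apply.
have [_ _ /(_ y x t t01)] := pF; rewrite -zE.
rewrite -fx -fy -(fineK (dom_fin_num pF (DF _ Dz))) -!EFinM -EFinD lee_fin/=.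
by lra.
Qed.

Context {f : E -> \bar R} {f_ : nat -> E -> \bar R}.
Hypotheses (pf : proper_convex f) (pf_ : forall n, proper_convex (f_ n)).
Hypothesis sum_f :
  forall x, (fun n => \sum_(0 <= k < n) f_ k x)%E @ \oo --> f x.

(** No term is [-oo], so an infinite term makes all later partial sums, hence [f x], equal to
    [+oo]. *)
Lemma dom_term n : dom f `<=` dom (f_ n).
Proof.
move=> x fx; rewrite /dom/= ltey; apply/eqP => fnx.
suff : f x = +oo%E by move=> fxy; rewrite /dom/= fxy in fx.
rewrite -(cvg_lim (@ereal_hausdorff R) (sum_f x)).
apply: cvg_lim; first exact: ereal_hausdorff.
apply: cvg_near_cst; near=> m; apply/esum_eqyP => [k _|]; first by case: (pf_ k).
exists n; split => //; rewrite mem_index_iota/=.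
by near: m; exact: nbhs_infty_gt.
Unshelve. all: by end_near. Qed.

Lemma fine_sum_dom n x : dom f x ->
  fine (\sum_(0 <= k < n) f_ k x)%E = \sum_(0 <= k < n) fine (f_ k x).
Proof.
move=> fx; rewrite sum_fine// => k _.
exact: dom_fin_num (pf_ k) (dom_term k _ fx).
Qed.

Lemma cvg_sum_fine x : dom f x ->
  (fun n => \sum_(0 <= k < n) fine (f_ k x)) @ \oo --> fine (f x).
Proof.
move=> fx; under eq_fun do rewrite -fine_sum_dom//.
by apply: fine_cvg; rewrite fineK// (dom_fin_num pf fx).
Qed.

Lemma rest_unif_cvg0_of_uniform {U : set E} : open U -> U !=set0 ->
  U `<=` dom f ->
  {uniform U, (fun n x => fine (\sum_(0 <= k < n) f_ k x)%E) @ \oo -->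
              (fun x => fine (f x))} ->
  exists u d, @rest_unif_cvg0 _ _ (dom f) (fine \o f) (fun k => fine \o f_ k) u d.
Proof.
move=> oU [u Uu] Uf uf.
have /nbhs_ballP[d /= d0 dU] : nbhs u U by exact: open_nbhs_nbhs.
have inU y : `|y - u| < d -> U y.
  by move=> yu; apply: dU; rewrite -ball_normE/= distrC.
exists u, d; split => // [y /inU/Uf//|e e0].
have [|N _ NP] := uf [set h | forall y, U y -> `|fine (f y) - h y| < e].
  apply/uniform_nbhs; exists [set ab : R * R | ball ab.1 e ab.2]; split.
    exact (@entourage_ball R R (PosNum e0)).
  by move=> h hU y Uy; have := hU y Uy; rewrite /= -ball_normE.
exists N => n y Nn /inU Uy; have := NP n Nn y Uy.
by rewrite fine_sum_dom; [move/ltW|exact: Uf].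
Qed.

End Transfer.

Theorem theorem10 (R : realType) (E : normedModType R)
  (f : E -> \bar R) (f_ : nat -> E -> \bar R)
  (Lf : proper_convex f) (Lf_ : forall n, proper_convex (f_ n))
  (sum_f : forall x : E, (fun n => \sum_(0 <= k < n) f_ k x)%E @ \oo --> f x)
  (cont_f : {within (dom f)°, continuous f})
  (cont_f_ : forall n, {within (dom f)°, continuous (f_ n)})
  (unif_f : exists U : set E, [/\ open U, U !=set0, U `<=` dom f &
     {uniform U, (fun n x => fine (\sum_(0 <= k < n) f_ k x)%E) @ \oo -->
                 (fun x => fine (f x))}]) :
  (forall x : E, (dom f)° x ->
     normal_cvg (fun n => subdiff (f_ n) x) (subdiff f x)) /\
  (forall x : E, (dom f)° x ->
     exists V : set E, [/\ nbhs x V, V `<=` (dom f)° &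
       forall eps : R, 0 < eps -> exists n0, forall n, (n0 <= n)%N ->
         forall y, V y ->
           (`|set_norm (tail_sum n (fun k => subdiff (f_ k) y))| < eps%:E)%E]).
Proof.
have [U [oU U0 Uf unifU]] := unif_f.
pose D := dom f; pose fr := fine \o f; pose fk k := fine \o f_ k.
have cvx_fk k : convex_on D (fk k).
  exact: fine_convex_on (Lf_ k) (dom_term Lf_ sum_f k) (convex_dom Lf).
have cvg_fk y : D y -> (fun n => \sum_(0 <= k < n) fk k y) @ \oo --> fr y.
  exact: cvg_sum_fine Lf Lf_ sum_f y.
have [u [d unif_u]] := rest_unif_cvg0_of_uniform Lf_ sum_f oU U0 Uf unifU.
(* Smallness reaches every interior point; halving the radius gives the [2 * r] form. *)
have unif_at x : D° x -> exists2 r, 0 < r & @rest_unif_cvg0 _ _ D fr fk x (2 * r).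
  move=> /nbhs_ballP[e /= e0 eD].
  have ballx y : `|y - x| < e -> D y.
    by move=> yx; apply: eD; rewrite -ball_normE/= distrC.
  have [r unif_x] := rest_unif_cvg0_interior cvx_fk cvg_fk unif_u e0 ballx.
  have [r0 _ _] := unif_x.
  by exists (r / 2); rewrite ?divr_gt0// mulrC divfK.
(* Continuity at [x], where [f_ k] is finite, bounds the increment by [1] nearby. *)
have bounded_at x k : D° x -> exists t e, 0 < t /\
    forall z, `|z - x| < t -> D z /\ fk k z - fk k x <= e.
  move=> Dx; have Dox : nbhs x D := Dx.
  have fkx : f_ k x = (fine (f_ k x))%:E.
    rewrite fineK//; apply: dom_fin_num (Lf_ k) _.
    exact: (dom_term Lf_ sum_f k x (nbhs_singleton Dox)).
  have : {for x, continuous (f_ k)}.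
    have := cont_f_ k; rewrite continuous_open_subspace; last exact: open_interior.
    by apply; rewrite inE.
  rewrite /prop_for /continuous_at fkx => /fine_cvg/cvgrPdist_lt/(_ 1 ltr01) nfk.
  have /nbhs_ballP[t /= t0 tP] : nbhs x (fun z => D z /\ fk k z - fk k x <= 1).
    apply: filterS2 Dox nfk => z Dz /= /ltW; rewrite distrC => /(le_trans (ler_norm _)).
    by [].
  exists t, 1; split => // z zx.
  by apply: tP; rewrite -ball_normE/= distrC.
have subE x k p : D° x -> subdiff (f_ k) x p <-> subgradient D (fk k) x p.
  move=> /unif_at[r _ [r0 ballx _]].
  exact: subdiffP (Lf_ k) (dom_term Lf_ sum_f k) r0 ballx.
have sub0E x p : D° x -> subdiff f x p <-> subgradient D (rest fr fk 0) x p.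
  move=> /unif_at[r _ [r0 ballx _]].
  have -> : rest fr fk 0 = fr by apply/funext => y; exact: rest0.
  exact: subdiffP Lf _ r0 ballx.
have sub_neq0 x k : D° x -> subdiff (f_ k) x !=set0.
  move=> Dx; have [r r0 unif_x] := unif_at x Dx.
  have [p px] := exists_dual_subgradient cvx_fk unif_x (bounded_at x ^~ Dx) k.
  by exists p; apply/subE.
have interior_dom x : D° x -> D x by exact: interior_subset.
split => x Dx; have [r r0 unif_x] := unif_at x Dx; have [_ ballx smallx] := unif_x.
- have xx : `|x - x| < r by rewrite subrr normr0.
  have selP n p_ : selection n (fun k => subdiff (f_ k) x) p_ ->
      forall k, (n <= k)%N -> subgradient D (fk k) x (p_ k).
    by move=> px k nk; apply/subE/px.
  have partI p_ : selection 0 (fun k => subdiff (f_ k) x) p_ ->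
      exists2 s, sums_to 0 p_ s & subdiff f x s.
    move=> /selP px.
    have [s ps] := summable_subgradients unif_x xx px.
    exists s => //; apply/sub0E => //.
    exact: (subgradient_sums_to cvg_fk (interior_dom _ Dx) px ps).
  split; [split|split] => //.
  (* Summing any selection by (I) shows that [subdiff f x] is nonempty. *)
  + have /choice[p_ px] k := sub_neq0 x k Dx.
    by have [s _ sx] := partI p_ (fun k _ => px k); exists s.
  + by move=> k; exact: sub_neq0.
  + move=> V /nbhs_ballP[e /= e0 eV].
    (* Turns the bound [4 * _ / r] into [e / 2], strictly below [e]. *)
    have e80 : 0 < e * r / 8 by rewrite divr_gt0// mulr_gt0.
    have [N small] := smallx _ e80; exists N => p_ /selP px n Nn.
    have pn k : (n <= k)%N -> subgradient D (fk k) x (p_ k) by move=> _; exact: px.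
    have [s ps] := summable_subgradients unif_x xx pn.
    exists s => //; apply: eV; rewrite -ball_normE/= sub0r normrN.
    have sx := subgradient_sums_to cvg_fk (interior_dom _ Dx) pn ps.
    rewrite (le_lt_trans (norm_subgradient_rest_le unif_x small e80 Nn xx sx))//.
    have -> : 4 * (e * r / 8) / r = e / 2 by field; rewrite lt0r_neq0.
    by rewrite ltr_pdivrMr// ltr_pMr// ltr1n.
  + move=> s /sub0E -/(_ Dx) sx.
    have [p_ [px ps]] :=
      decompose_subgradient cvx_fk cvg_fk unif_x (bounded_at x ^~ Dx) sx.
    by exists p_ => // k _; apply/subE.
- pose V := [set y | `|y - x| < r].
  have VD y : V y -> D° y.
    move=> yx; apply/nbhs_ballP; exists r => // z; rewrite -ball_normE/= => yz.
    apply: ballx; rewrite (le_lt_trans (ler_distD y _ _))//.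
    by rewrite distrC mulr_natl mulr2n ltrD.
  exists V; split => //.
    by apply/nbhs_ballP; exists r => // y; rewrite -ball_normE/= distrC.
  move=> e e0; have e80 : 0 < e * r / 8 by rewrite divr_gt0// mulr_gt0.
  (* [N] comes from the ball around [x] and does not depend on [y]. *)
  have [N small] := smallx _ e80; exists N => n Nn y Vy; have Dy := VD y Vy.
  have tail_le s : tail_sum n (fun k => subdiff (f_ k) y) s -> `|s| <= e / 2.
    move=> [p_ py ps].
    have {}py k : (n <= k)%N -> subgradient D (fk k) y (p_ k).
      by move=> nk; apply/subE => //; exact: py.
    have sy := subgradient_sums_to cvg_fk (interior_dom _ Dy) py ps.
    rewrite (le_trans (norm_subgradient_rest_le unif_x small e80 Nn Vy sy))//.
    by rewrite le_eqVlt; apply/orP; left; apply/eqP; field; rewrite lt0r_neq0.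
  have [s ts] : tail_sum n (fun k => subdiff (f_ k) y) !=set0.
    have /choice[p_ py] k := sub_neq0 y k Dy.
    have [s ps] := summable_subgradients unif_x Vy
      (fun k _ => (subE y k (p_ k) Dy).1 (py k)) (n := n).
    by exists s, p_.
  rewrite gee0_abs; last first.
    by apply: ereal_sup_ge; exists `|s|%:E; [exists s|rewrite lee_fin].
  apply: (@le_lt_trans _ _ (e / 2)%:E).
    by apply: ge_ereal_sup => _ [t /tail_le te <-]; rewrite lee_fin.
  by rewrite lte_fin ltr_pdivrMr// ltr_pMr// ltr1n.
Qed.
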